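(* Let $G$ be a group, $H\le G$ a subgroup of finite index, and $\alpha$ a quasi-action of $H$ on an unbounded metric space $X$. Then there exist metric spaces $X_i$ ($i\in G/H$, the set of left cosets) and a quasi-action $\beta$ of $G$ on $\prod_{i\in G/H}X_i$ preserving the product structure such that: (1) each factor $X_i$ is quasi-isometric to $X$; (2) the associated permutation action of $G$ on the index set $G/H$ is the natural action by left multiplication; (3) the restriction of $\beta$ to a quasi-action of $H$ (the stabilizer of the coset $H\in G/H$) on the factor $X_H$ is quasi-conjugate to $\alpha$. Furthermore, such a quasi-action is unique up to quasi-conjugacy by a product quasi-isometry: if $\beta$ on $\prod_{i\in G/H}X_i$ and $\beta'$ on $\prod_{i\in G/H}X'_i$ are two quasi-actions of $G$ preserving the product structure and satisfying (1)-(3), then $\beta$ is quasi-conjugate to $\beta'$ via a product quasi-isometry $\prod_i X_i\to\prod_i X_i'$. Finally, if $\alpha$ is an isometric action, then the $X_i$ may be taken isometric to $X$ and $\beta$ may be taken to be an isometric action.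
   Context: Quasi-isometries. For $L\ge 1$, $A\ge 0$, a map $f:Z\to Z'$ of metric spaces is an $(L,A)$-quasi-isometry if $\frac1L d(x,y)-A\le d(f(x),f(y))\le L\,d(x,y)+A$ for all $x,y\in Z$ and every point of $Z'$ is within distance $A$ of $f(Z)$. A quasi-isometry is an $(L,A)$-quasi-isometry for some $L,A$. Quasi-actions. An $(L,A)$-quasi-action of a group $G$ on $Z$ is a map $\rho:G\times Z\to Z$, written $\rho(g)=\rho(g,\cdot)$, such that each $\rho(g)$ is an $(L,A)$-quasi-isometry, $d(\rho(g_1)\rho(g_2)z,\rho(g_1g_2)z)\le A$ and $d(\rho(e)z,z)\le A$ for all $g_1,g_2\in G$, $z\in Z$. A quasi-action is an $(L,A)$-quasi-action for some $L,A$. Two quasi-actions $\rho,\rho'$ of $G$ on $Z$ are equivalent if $\sup_{g,z}d(\rho(g)z,\rho'(g)z)<\infty$. A quasi-action $\rho$ on $Z$ is quasi-conjugate to $\rho'$ on $Z'$ via a quasi-isometry $\phi:Z\to Z'$ if $\sup_{g\in G,z\in Z}d(\phi(\rho(g)z),\rho'(g)\phi(z))<\infty$. Products. Let $\{X_i\}_{i\in I}$ be a finite collection of unbounded metric spaces; $\prod_i X_i$ carries the $L^2$-product metric. A quasi-action $\rho$ of $G$ on $\prod_iX_i$ preserves the product structure if there is a constant $D$ such that for every $g\in G$ there are a permutation $\sigma=\sigma_g$ of $I$ and quasi-isometries $\phi_i=\phi_i^g:X_i\to X_{\sigma(i)}$ such that $\rho(g)$ is at sup-distance at most $D$ from the map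 $(x_i)_{i}\mapsto\bigl(\phi_{\sigma^{-1}(i)}(x_{\sigma^{-1}(i)})\bigr)_{i}$. Since the $X_i$ are unbounded, $\sigma_g$ is uniquely determined and $g\mapsto\sigma_g$ is an action of $G$ on $I$, the associated permutation action. For $i\in I$ with stabilizer $G_i$, the restricted quasi-action of $G_i$ on $X_i$ is $g\mapsto\phi_i^g$; it is well defined up to equivalence. A product quasi-isometry $\prod_{i\in I}X_i\to\prod_{i\in I}X'_i$ is a quasi-isometry at bounded sup-distance from a map $(x_i)\mapsto(\phi_i(x_i))$ with each $\phi_i:X_i\to X_i'$ a quasi-isometry. *)

(* Defs.v *)
From HB Require Import structures.
From mathcomp Require Import all_boot all_order all_algebra perm.
From mathcomp Require Import generic_quotient ring.
From mathcomp Require Import boolp classical_sets functions cardinality reals.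
From mathcomp Require Import topology.

Set Implicit Arguments.
Unset Strict Implicit.
Unset Printing Implicit Defensive.

Import Order.TTheory GRing.Theory Num.Theory.
Local Open Scope ring_scope.

Section QuasiIsometries.
Context {R : realType}.

Definition unbounded (Z : metricType R) : Prop :=
  forall C : R, exists x y : Z, C < mdist x y.

Definition quasi_isometry_with (L A : R) (Z Z' : metricType R) (f : Z -> Z') :
    Prop :=
  [/\ 1 <= L, 0 <= A,
      forall x y, L^-1 * mdist x y - A <= mdist (f x) (f y) /\
                  mdist (f x) (f y) <= L * mdist x y + A
    & forall z', exists z, mdist z' (f z) <= A].

Definition quasi_isometry (Z Z' : metricType R) (f : Z -> Z') : Prop :=
  exists L A, quasi_isometry_with L A f.

Definition quasi_isometric (Z Z' : metricType R) : Prop :=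
  exists f : Z -> Z', quasi_isometry f.

Definition isometry (Z Z' : metricType R) (f : Z -> Z') : Prop :=
  bijective f /\ forall x y, mdist (f x) (f y) = mdist x y.

Definition isometric (Z Z' : metricType R) : Prop :=
  exists f : Z -> Z', isometry f.

Definition bounded_distance (T : Type) (Z : metricType R) (f f' : T -> Z) :
    Prop :=
  exists D : R, forall t, mdist (f t) (f' t) <= D.

End QuasiIsometries.

Section QuasiActions.
Context {R : realType} {G : groupType}.

Definition quasi_action_with (L A : R) (Z : metricType R) (rho : G -> Z -> Z) :
    Prop :=
  [/\ forall g, quasi_isometry_with L A (rho g),
      forall g1 g2 z, mdist (rho g1 (rho g2 z)) (rho (g1 * g2)%g z) <= A
    & forall z, mdist (rho 1%g z) z <= A].

Definition quasi_action (Z : metricType R) (rho : G -> Z -> Z) : Prop :=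
  exists L A, quasi_action_with L A rho.

Definition isometric_action (Z : metricType R) (rho : G -> Z -> Z) : Prop :=
  [/\ forall g, isometry (rho g),
      forall g1 g2 z, rho g1 (rho g2 z) = rho (g1 * g2)%g z
    & forall z, rho 1%g z = z].

Definition quasi_conjugate_via (Z Z' : metricType R)
    (rho : G -> Z -> Z) (rho' : G -> Z' -> Z') (phi : Z -> Z') : Prop :=
  quasi_isometry phi /\
  exists C : R, forall g z, mdist (phi (rho g z)) (rho' g (phi z)) <= C.

Definition quasi_conjugate (Z Z' : metricType R)
    (rho : G -> Z -> Z) (rho' : G -> Z' -> Z') : Prop :=
  exists phi : Z -> Z', quasi_conjugate_via rho rho' phi.

End QuasiActions.

(* The product type, kept as an alias so that it carries the L^2 metric and not
   the product uniform structure of the library. *)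
Definition l2prod {R : realType} {I : finType} (X : I -> metricType R) : Type :=
  forall i, X i.

Section L2Metric.
Context {R : realType} {I : finType} (X : I -> metricType R).

HB.instance Definition _ := gen_eqMixin (l2prod X).
HB.instance Definition _ := gen_choiceMixin (l2prod X).

Definition l2dist (x y : l2prod X) : R :=
  Num.sqrt (\sum_i mdist (x i) (y i) ^+ 2).

Let l2distxx x : l2dist x x = 0.
Proof.
by rewrite /l2dist big1 ?sqrtr0// => i _; rewrite mdistxx expr0n.
Qed.

Let l2dist_positivity x y : l2dist x y = 0 -> x = y.
Proof.
move=> /eqP; rewrite sqrtr_eq0 => le0; apply: functional_extensionality_dep => i.
apply: (@mdist_positivity R); apply/eqP; rewrite -sqrf_eq0 eq_le sqr_ge0 andbT.
apply: le_trans le0; rewrite (bigD1 i)//= lerDl.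
by apply: sumr_ge0 => j _; exact: sqr_ge0.
Qed.

Let l2dist_sym x y : l2dist x y = l2dist y x.
Proof. by congr Num.sqrt; apply: eq_bigr => i _; rewrite metric_sym. Qed.

Let cauchy_schwarz (a b : I -> R) :
  (\sum_i a i * b i) ^+ 2 <= (\sum_i a i ^+ 2) * (\sum_i b i ^+ 2).
Proof.
set S := \sum_i a i * b i; set P := \sum_i a i ^+ 2; set Q := \sum_i b i ^+ 2.
have Q0 : 0 <= Q by apply: sumr_ge0 => i _; exact: sqr_ge0.
have : 0 <= \sum_i (Q * a i - S * b i) ^+ 2.
  by apply: sumr_ge0 => i _; exact: sqr_ge0.
have -> : \sum_i (Q * a i - S * b i) ^+ 2 = Q * (P * Q - S ^+ 2).
  transitivity (\sum_i (Q ^+ 2 * a i ^+ 2 - 2 * Q * S * (a i * b i)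
                        + S ^+ 2 * b i ^+ 2)).
    by apply: eq_bigr => i _; ring.
  by rewrite big_split sumrB/= -!mulr_sumr -/P -/Q -/S; ring.
have [Q_gt0|] := ltP 0 Q; first by rewrite pmulr_rge0// subr_ge0.
move=> Qle0; have {Q0}Q0 : Q = 0 by apply/eqP; rewrite eq_le Qle0.
move=> _; rewrite Q0 mulr0 /S big1 ?expr0n// => i _.
suff -> : b i = 0 by rewrite mulr0.
apply/eqP; rewrite -sqrf_eq0; apply/eqP.
by apply: (psumr_eq0P _ Q0) => // j _; exact: sqr_ge0.
Qed.

Let l2dist_triangle y x z : l2dist x z <= l2dist x y + l2dist y z.
Proof.
have s0 (a : I -> R) : 0 <= \sum_i a i ^+ 2.
  by apply: sumr_ge0 => i _; exact: sqr_ge0.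
rewrite -(@ler_pXn2r _ 2)// ?nnegrE ?addr_ge0 ?sqrtr_ge0//.
rewrite sqrrD !sqr_sqrtr ?s0// -sqrtrM ?s0//.
set a := fun i => mdist (x i) (y i); set b := fun i => mdist (y i) (z i).
apply: (@le_trans _ _ (\sum_i (a i + b i) ^+ 2)).
  apply: ler_sum => i _; rewrite ler_pXn2r// ?nnegrE ?addr_ge0 ?mdist_ge0//.
  exact: metric_triangle.
under eq_bigr => i _ do rewrite sqrrD.
rewrite !big_split/= -mulr2n lerD2r lerD2l lerMn2r/=.
apply: le_trans (ler_norm _) _; rewrite -sqrtr_sqr ler_sqrt ?mulr_ge0 ?s0//.
Qed.

HB.instance Definition _ := isMetric.Build R (l2prod X)
  l2distxx l2dist_positivity l2dist_sym l2dist_triangle.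

Lemma mdist_l2prodE (x y : l2prod X) :
  mdist x y = Num.sqrt (\sum_i mdist (x i) (y i) ^+ 2).
Proof. by []. Qed.

End L2Metric.

Section Products.
Context {R : realType} {I : finType}.

(* (x_i)_i |-> (phi_{s^-1 j} (x_{s^-1 j}))_j; the cast is along s (s^-1 j) = j *)
Definition prod_map (X : I -> metricType R) (s : {perm I})
    (phi : forall i, X i -> X (s i)) (x : l2prod X) : l2prod X :=
  fun j => ecast k (X k) (permKV s j) (phi ((s^-1)%g j) (x ((s^-1)%g j))).

Lemma prod_mapE (X : I -> metricType R) (s : {perm I})
    (phi : forall i, X i -> X (s i)) (x : l2prod X) (i : I) :
  prod_map phi x (s i) = phi i (x i).
Proof.
rewrite /prod_map; move: (permKV s (s i)); rewrite (permK s i) => e.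
by rewrite eq_axiomK.
Qed.

Definition splits_with (X : I -> metricType R) (D : R)
    (f : l2prod X -> l2prod X) (s : {perm I}) (phi : forall i, X i -> X (s i)) :
    Prop :=
  (forall i, quasi_isometry (phi i)) /\
  forall x, mdist (f x) (prod_map phi x) <= D.

Definition product_quasi_isometry (X X' : I -> metricType R)
    (f : l2prod X -> l2prod X') : Prop :=
  quasi_isometry f /\
  exists phi : forall i, X i -> X' i,
    (forall i, quasi_isometry (phi i)) /\
    bounded_distance f (fun x => (fun i => phi i (x i)) : l2prod X').

Context {G : groupType} (X : I -> metricType R).
Implicit Type rho : G -> l2prod X -> l2prod X.

Definition preserves_product rho : Prop :=
  exists D : R, forall g, exists (s : {perm I}) (phi : forall i, X i -> X (s i)),
    splits_with D (rho g) phi.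

(* When the X i are unbounded, at most one s satisfies this. *)
Definition associated_permutation_action rho (s : G -> {perm I}) : Prop :=
  exists D : R, forall g, exists phi : forall i, X i -> X (s g i),
    splits_with D (rho g) phi.

End Products.

Section Subgroups.
Context {G : groupType} (H : groupClosed G).

Definition subgroup : Type := {x : G | x \in H}.

HB.instance Definition _ := SubChoice.on subgroup.

Let subgroup_closed : group_closed H.
Proof. by split; [exact: gpred1 | exact: gpredF]. Qed.

HB.instance Definition _ :=
  SubChoice_isSubGroup.Build G (mem H) subgroup subgroup_closed.

(* x H = y H *)
Definition lcoset_rel : rel G := fun x y => (x^-1 * y)%g \in H.

Let lcoset_rel_refl : reflexive lcoset_rel.
Proof. by move=> x; rewrite /lcoset_rel mulVg gpred1. Qed.

Let lcoset_rel_sym : symmetric lcoset_rel.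
Proof.
by move=> x y; rewrite /lcoset_rel -[in RHS]gpredV invgM invgK.
Qed.

Let lcoset_rel_trans : transitive lcoset_rel.
Proof.
move=> y x z xy yz; rewrite /lcoset_rel.
by rewrite -[z](mulVKg y) mulgA gpredM.
Qed.

Canonical lcoset_equiv :=
  EquivRel lcoset_rel lcoset_rel_refl lcoset_rel_sym lcoset_rel_trans.

Local Open Scope quotient_scope.

Definition lcosets : Type := {eq_quot lcoset_rel}.
HB.instance Definition _ := Choice.on lcosets.
HB.instance Definition _ := EqQuotient.on lcosets.

Lemma lcosets_eqP (x y : G) :
  \pi_lcosets x = \pi_lcosets y <-> (x^-1 * y)%g \in H.
Proof. by split=> [/eqmodP|xy]; last exact/eqmodP. Qed.

Definition finite_index : Prop := finite_set [set: lcosets]%classic.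

(* Same carrier as lcosets; finH is what its finType instance is built from. *)
Definition lcosetF (finH : finite_index) : Type := lcosets.

Section FiniteIndex.
Variable finH : finite_index.

HB.instance Definition _ := Choice.on (lcosetF finH).

Let lcoset_enum : seq (lcosetF finH) :=
  sval (cid ((finite_seqP _).1 finH)).

Let mem_lcoset_enum (c : lcosetF finH) : c \in lcoset_enum.
Proof.
rewrite /lcoset_enum; case: cid => s /= sE.
by have : [set: lcosets]%classic c by []; rewrite sE.
Qed.

Let lcoset_pickleK :
  pcancel (fun c => index c lcoset_enum) (fun n => onth lcoset_enum n).
Proof.
move=> c; have ic : (index c lcoset_enum < size lcoset_enum)%N.
  by rewrite index_mem.
by rewrite onthE (nth_map c) // nth_index.
Qed.

HB.instance Definition _ :=
  Choice_isCountable.Build (lcosetF finH) lcoset_pickleK.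

Let lcoset_enumP : Finite.axiom (undup lcoset_enum).
Proof.
by move=> c; rewrite count_uniq_mem ?undup_uniq// mem_undup mem_lcoset_enum.
Qed.

HB.instance Definition _ := isFinite.Build (lcosetF finH) lcoset_enumP.

Definition lcosetF_of (x : G) : lcosetF finH := \pi_lcosets x.

Definition lmulc (g : G) (c : lcosetF finH) : lcosetF finH :=
  lcosetF_of (g * repr (c : lcosets))%g.

Lemma lmulcE (g x : G) : lmulc g (lcosetF_of x) = lcosetF_of (g * x)%g.
Proof.
apply/lcosets_eqP; rewrite invgM -mulgA mulKg.
by apply/lcosets_eqP; rewrite reprK.
Qed.

Lemma lcosetF_surj (c : lcosetF finH) : exists x, c = lcosetF_of x.
Proof. by exists (repr (c : lcosets)); rewrite /lcosetF_of reprK. Qed.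

Lemma lmulc_inj (g : G) : injective (lmulc g).
Proof.
move=> c d; have [x ->] := lcosetF_surj c; have [y ->] := lcosetF_surj d.
rewrite !lmulcE => /lcosets_eqP; rewrite invgM -mulgA mulKg => xy.
exact/lcosets_eqP.
Qed.

Definition lmul_perm (g : G) : {perm lcosetF finH} := perm (@lmulc_inj g).

Lemma lmul_perm_stab (g : G) :
  lmul_perm g (lcosetF_of 1%g) = lcosetF_of 1%g <-> g \in H.
Proof.
rewrite permE lmulcE mulg1; split=> [/lcosets_eqP|gH].
  by rewrite mulg1 gpredV.
by apply/lcosets_eqP; rewrite mulg1 gpredV.
Qed.

End FiniteIndex.

End Subgroups.

(* r is (g |-> phi_i^g) for g in K.  The equation s i = i, required for every
   g in K, forces K to lie in the stabilizer of i. *)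
Definition restricted_quasi_action {R : realType} {I : finType} {G : groupType}
    (X : I -> metricType R) (rho : G -> l2prod X -> l2prod X) (i : I)
    (K : groupClosed G) (r : subgroup K -> X i -> X i) : Prop :=
  exists D : R, forall g : subgroup K,
    exists (s : {perm I}) (phi : forall j, X j -> X (s j)) (e : s i = i),
      splits_with D (rho (val g)) phi /\
      forall x, r g x = ecast j (X j) e (phi i x).

Section Induced.
Context {R : realType} {G : groupType} (H : groupClosed G).
Context (finH : finite_index H) (X : metricType R).

Definition induced_quasi_action (alpha : subgroup H -> X -> X)
    (Y : lcosetF finH -> metricType R) (beta : G -> l2prod Y -> l2prod Y) :
    Prop :=
  [/\ quasi_action beta,
      preserves_product beta,
      forall i, quasi_isometric (Y i) X,
      associated_permutation_action beta (lmul_perm finH)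
    & exists r : subgroup H -> Y (lcosetF_of finH 1%g) -> Y (lcosetF_of finH 1%g),
        restricted_quasi_action beta r /\ quasi_conjugate r alpha].

End Induced.

(* Main.v *)
(** Existence: choose representatives [g_i] of the cosets [i] and put
    [(beta g x)_{gi} = alpha (g_{gi}^-1 g g_i) x_i]; since
    [(g, i) |-> g_{gi}^-1 g g_i] is an [H]-valued cocycle, [beta] is as close to
    an action as [alpha] is, and [alpha g_H] conjugates its restriction to [H]
    on the factor [H] to [alpha].

    Uniqueness: both restrictions to [H] are quasi-conjugate to [alpha], hence
    to each other, by some [phi_H].  Writing [phi_i^g : X_i -> X_{gi}] for the
    factor maps of [beta], and similarly for [beta'], the quasi-isometry
    [phi_i := phi'_H^{g_i} o phi_H o phi_i^{g_i^-1}] is the only possible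
    choice up to bounded error; that [phi] intertwines [beta g] and [beta' g]
    follows from [g_{gi}^-1 g = h g_i^-1] with [h] in [H]. *)
Require Import Defs.
From mathcomp Require Import all_boot all_order all_algebra perm.
From mathcomp Require Import generic_quotient lra.
From mathcomp Require Import boolp reals topology.

Set Implicit Arguments.
Unset Strict Implicit.
Unset Printing Implicit Defensive.

Import Order.TTheory GRing.Theory Num.Theory.
Local Open Scope ring_scope.

(** One constant serves as factor and as error, and the lower bound is free of inverses, so
    estimates become polynomial inequalities in the constants. *)
Definition quasi_isometry_const {R : realType} (K : R) (Z Z' : metricType R)
    (f : Z -> Z') : Prop :=
  [/\ 1 <= K,
      forall x y, mdist (f x) (f y) <= K * mdist x y + K,
      forall x y, mdist x y <= K * mdist (f x) (f y) + K
    & forall z', exists z, mdist z' (f z) <= K].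

(** * Composites, perturbations and quasi-inverses of quasi-isometries *)

Section Coarse.
Context {R : realType}.
Implicit Types (Z : metricType R) (K L A D : R).

Lemma mdist_path3 Z (a b c d : Z) :
  mdist a d <= mdist a b + mdist b c + mdist c d.
Proof.
by apply: le_trans (metric_triangle a c d) _; rewrite lerD2r metric_triangle.
Qed.

(** Multiplying the lower bound by [L] leaves the error [L * A]; the constant dominates this as well
    as [L] and [A]. *)
Lemma quasi_isometry_with_const L A (Z Z' : metricType R) (f : Z -> Z') :
  quasi_isometry_with L A f -> quasi_isometry_const (L * (A + 1)) f.
Proof.
case=> L1 A0 fLA fA; split; first by nra.
- move=> x y; have [_ h] := fLA x y; have := mdist_ge0 x y.
  move=> d0; have : 0 <= L * A * mdist x y by rewrite !mulr_ge0//; lra.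
  nra.
- move=> x y; have [h _] := fLA x y; have d0 := mdist_ge0 (f x) (f y).
  have L0 : 0 < L by lra.
  have : mdist x y <= L * (mdist (f x) (f y) + A).
    by rewrite -ler_pdivrMl// -lerBlDr.
  have : 0 <= L * A * mdist (f x) (f y) by rewrite !mulr_ge0//; lra.
  nra.
- by move=> z'; have [z zA] := fA z'; exists z; apply: le_trans zA _; nra.
Qed.

Lemma const_quasi_isometry_with K (Z Z' : metricType R) (f : Z -> Z') :
  quasi_isometry_const K f -> quasi_isometry_with K K f.
Proof.
case=> K1 up lo surj; split=> //; first by lra.
move=> x y; split; last exact: up.
have K0 : 0 < K by lra.
rewrite lerBlDr ler_pdivrMl// mulrDr; apply: le_trans (lo x y) _.
by rewrite lerD2l; nra.
Qed.

Lemma quasi_isometryP (Z Z' : metricType R) (f : Z -> Z') :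
  quasi_isometry f <-> exists K, quasi_isometry_const K f.
Proof.
split=> [[L [A]] /quasi_isometry_with_const|[K /const_quasi_isometry_with]] h.
  by eexists; exact: h.
by exists K, K.
Qed.

Lemma quasi_isometry_constW K K' (Z Z' : metricType R) (f : Z -> Z') :
  K <= K' -> quasi_isometry_const K f -> quasi_isometry_const K' f.
Proof.
move=> KK' [K1 up lo surj]; split; first by lra.
- move=> x y; apply: le_trans (up x y) _; have := mdist_ge0 x y; nra.
- move=> x y; apply: le_trans (lo x y) _; have := mdist_ge0 (f x) (f y); nra.
- by move=> z'; have [z zK] := surj z'; exists z; apply: le_trans KK'.
Qed.

Lemma quasi_isometry_id Z : quasi_isometry (@id Z).
Proof.
apply/quasi_isometryP; exists 1; split=> //.
1,2: by move=> x y; rewrite mul1r lerDl.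
by move=> z; exists z; rewrite mdistxx.
Qed.

Lemma quasi_isometry_comp (Z1 Z2 Z3 : metricType R) (f : Z1 -> Z2)
    (g : Z2 -> Z3) :
  quasi_isometry f -> quasi_isometry g -> quasi_isometry (g \o f).
Proof.
move=> /quasi_isometryP[K [K1 fup flo fs]] /quasi_isometryP[L [L1 gup glo gs]].
apply/quasi_isometryP; exists (K * L + 2 * K + 2 * L); split; first by nra.
- move=> x y /=; have := gup (f x) (f y); have := fup x y.
  have := mdist_ge0 x y; set a := mdist _ _; set b := mdist _ _; nra.
- move=> x y /=; have := glo (f x) (f y); have := flo x y.
  have := mdist_ge0 (g (f x)) (g (f y)).
  set a := mdist _ _; set b := mdist _ _; nra.
- move=> z; have [y zy] := gs z; have [x yx] := fs y; exists x => /=.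
  have := gup y (f x); have := metric_triangle z (g y) (g (f x)); nra.
Qed.

Lemma quasi_isometry_close (Z Z' : metricType R) (f f' : Z -> Z') :
  bounded_distance f f' -> quasi_isometry f -> quasi_isometry f'.
Proof.
move=> [D0 ff'0] /quasi_isometryP[K [K1 up lo surj]].
(* If [Z] is empty, [D0] may be negative. *)
pose D := `|D0|; have D_ge0 : 0 <= D by exact: normr_ge0.
have ff' z : mdist (f z) (f' z) <= D by exact: le_trans (ler_norm _).
have f'f z : mdist (f' z) (f z) <= D by rewrite metric_sym.
apply/quasi_isometryP; exists (K * (1 + 2 * D)); split; first by nra.
- move=> x y; have := up x y; have := f'f x; have := ff' y.
  have := mdist_path3 (f' x) (f x) (f y) (f' y); have := mdist_ge0 x y.
  set d := mdist x y; have : 0 <= K * D by nra.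
  nra.
- move=> x y; have := lo x y; have := ff' x; have := f'f y.
  have := mdist_path3 (f x) (f' x) (f' y) (f y).
  have := mdist_ge0 (f' x) (f' y).
  have : 0 <= K * D by nra.
  set d := mdist (f' x) _; nra.
- move=> z'; have [z z'z] := surj z'; exists z.
  have := metric_triangle z' (f z) (f' z); have := ff' z; nra.
Qed.

(** [g] chooses near-preimages, so [f \o g] is near the identity. Hence [f (g (f z))] is near [f z],
    and the lower bound for [f] brings [g (f z)] near [z]. *)
Lemma quasi_isometry_inverse (Z Z' : metricType R) (f : Z -> Z') :
  quasi_isometry f ->
  exists g : Z' -> Z, [/\ quasi_isometry g, bounded_distance (f \o g) id
                        & bounded_distance (g \o f) id].
Proof.
move=> /quasi_isometryP[K [K1 up lo /choice[g fg]]].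
have gf z : mdist (g (f z)) z <= K * K + K.
  apply: le_trans (lo _ _) _; rewrite lerD2r ler_pM2l; last by lra.
  by rewrite metric_sym.
have gfK z' : mdist (f (g z')) z' <= K by rewrite metric_sym.
exists g; split; last 2 first.
- by exists K.
- by exists (K * K + K).
apply/quasi_isometryP; exists (3 * (K * K)); split; first by nra.
- move=> x y; have := lo (g x) (g y); have := gfK x; have := fg y.
  have := mdist_path3 (f (g x)) x y (f (g y)); have := mdist_ge0 x y.
  set d := mdist x y; set e := mdist (f (g x)) (f (g y)).
  have : K <= K * K by nra.
  nra.
- move=> x y; have := up (g x) (g y); have := gfK y; have := fg x.
  have := mdist_path3 x (f (g x)) (f (g y)) y; have := mdist_ge0 (g x) (g y).
  set d := mdist (g x) _; set e := mdist (f (g x)) (f (g y)).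
  have : K <= K * K by nra.
  nra.
- move=> z; exists (f z); rewrite metric_sym; apply: le_trans (gf z) _; nra.
Qed.

End Coarse.

(** * The L^2 metric against coordinatewise bounds *)

Section L2.
Context {R : realType} {I : finType}.
Implicit Types X : I -> metricType R.

Lemma mdist_coord_le X (x y : l2prod X) i : mdist (x i) (y i) <= mdist x y.
Proof.
have d0 j : 0 <= mdist (x j) (y j) ^+ 2 by exact: sqr_ge0.
rewrite mdist_l2prodE -[leLHS]ger0_norm ?mdist_ge0// -sqrtr_sqr.
rewrite ler_sqrt; last exact: sumr_ge0.
by rewrite (bigD1 i)//= lerDl sumr_ge0.
Qed.

(** The factor is cruder than the square root of [#|I|], but avoids roots and is at least 1 even
    when [I] is empty. *)
Lemma mdist_l2_le X (x y : l2prod X) c : 0 <= c ->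
  (forall i, mdist (x i) (y i) <= c) -> mdist x y <= #|I|.+1%:R * c.
Proof.
move=> c0 xyc; rewrite mdist_l2prodE -[leRHS]ger0_norm ?mulr_ge0//.
rewrite -sqrtr_sqr ler_sqrt ?sqr_ge0//.
apply: (@le_trans _ _ (\sum_(i : I) c ^+ 2)).
  by apply: ler_sum => i _; rewrite ler_pXn2r ?nnegrE ?mdist_ge0.
rewrite sumr_const -(mulr_natl (c ^+ 2)) exprMn ler_wpM2r ?sqr_ge0//.
by rewrite -natrX ler_nat expnS expn1 mulnS; apply: leqW; rewrite leq_addr.
Qed.

(* The bijection is a plain function so that [s := id] needs no cast between
   [X' (s i)] and [X' i]. *)
Lemma quasi_isometry_const_coord X X' (s : I -> I) (K : R)
    (phi : forall i, X i -> X' (s i)) (f : l2prod X -> l2prod X') :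
  1 <= K -> bijective s -> (forall x i, f x (s i) = phi i (x i)) ->
  (forall i, quasi_isometry_const K (phi i)) ->
  quasi_isometry_const (#|I|.+1%:R * K) f.
Proof.
move=> K1 [t sK tK] fE phiK; have n1 : 1 <= #|I|.+1%:R :> R by rewrite ler1n.
split; first by nra.
- move=> x y; rewrite -mulrA -mulrDr.
  apply: mdist_l2_le => [|j]; first by have := mdist_ge0 x y; nra.
  rewrite -(tK j) !fE; have [_ up _ _] := phiK (t j).
  by apply: le_trans (up _ _) _; have := mdist_coord_le x y (t j); nra.
- move=> x y; rewrite -mulrA -mulrDr.
  apply: mdist_l2_le => [|i]; first by have := mdist_ge0 (f x) (f y); nra.
  have [_ _ lo _] := phiK i; apply: le_trans (lo _ _) _; rewrite -!fE.
  by have := mdist_coord_le (f x) (f y) (s i); nra.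
- move=> z'.
  have surj i : exists z, mdist (z' (s i)) (phi i z) <= K.
    by have [_ _ _] := phiK i; exact.
  exists (fun i => sval (cid (surj i))).
  apply: mdist_l2_le => [|j]; first by lra.
  by rewrite -(tK j) fE; exact: (svalP (cid (surj (t j)))).
Qed.

Lemma quasi_isometry_pointwise X X' (phi : forall i, X i -> X' i) :
  (forall i, quasi_isometry (phi i)) ->
  quasi_isometry ((fun x i => phi i (x i)) : l2prod X -> l2prod X').
Proof.
move=> qphi.
have /choice[K phiK] : forall i, exists K, quasi_isometry_const K (phi i).
  by move=> i; exact/quasi_isometryP.
have K0 i : 0 <= K i by have [] := phiK i; lra.
(* The sum bounds every [K i]; the added 1 covers an empty [I]. *)
have K'1 : 1 <= 1 + \sum_i K i by rewrite lerDl sumr_ge0.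
apply/quasi_isometryP; eexists.
apply: (@quasi_isometry_const_coord X X' id _ phi) K'1 _ _ _ => //.
  by exists id.
move=> i; apply: quasi_isometry_constW (phiK i).
by rewrite (bigD1 i)//= addrCA lerDl addr_ge0 ?sumr_ge0.
Qed.

End L2.

(** * The cocycle of the action on cosets *)

Section CosetCocycle.
Context {G : groupType} {H : groupClosed G} (finH : finite_index H).
Local Notation I := (lcosetF finH).
Implicit Types (g : G) (i : I).

Definition coset_rep i : G := repr (i : lcosets H).

Lemma coset_repK i : lcosetF_of finH (coset_rep i) = i.
Proof. by rewrite /lcosetF_of reprK. Qed.

Lemma lmulcM g1 g2 i : lmulc (g1 * g2)%g i = lmulc g1 (lmulc g2 i).
Proof. by rewrite -(coset_repK i) !lmulcE mulgA. Qed.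

Lemma lmulc1 i : lmulc 1%g i = i.
Proof. by rewrite -(coset_repK i) lmulcE mul1g. Qed.

Lemma lmulcVK g i : lmulc g (lmulc g^-1%g i) = i.
Proof. by rewrite -lmulcM mulgV lmulc1. Qed.

Lemma lmul_permE g i : lmul_perm finH g i = lmulc g i.
Proof. by rewrite permE. Qed.

Lemma lmulc_rep i : lmulc (coset_rep i) (lcosetF_of finH 1%g) = i.
Proof. by rewrite lmulcE mulg1 coset_repK. Qed.

Lemma coset_cocycle_subproof g i :
  ((coset_rep (lmulc g i))^-1 * (g * coset_rep i))%g \in H.
Proof. by apply/(lcosets_eqP H); rewrite reprK. Qed.

Definition coset_cocycle g i : subgroup H :=
  exist (fun x : G => x \in H) _ (coset_cocycle_subproof g i).

Lemma coset_cocycleE g i :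
  (coset_rep (lmulc g i) * val (coset_cocycle g i) = g * coset_rep i)%g.
Proof. exact: mulVKg. Qed.

(** Multiplied on the left by the representative of [g1 g2 i], both sides become
    [g1 * g2 * coset_rep i]. *)
Lemma coset_cocycleM g1 g2 i :
  coset_cocycle (g1 * g2)%g i
  = (coset_cocycle g1 (lmulc g2 i) * coset_cocycle g2 i)%g.
Proof.
apply: val_inj; apply: (mulgI (coset_rep (lmulc (g1 * g2)%g i))).
rewrite valM coset_cocycleE mulgA {1}lmulcM coset_cocycleE -!mulgA.
by rewrite coset_cocycleE.
Qed.

Lemma coset_cocycle1 i : coset_cocycle 1%g i = 1%g.
Proof.
apply: val_inj; apply: (mulgI (coset_rep (lmulc 1%g i))).
by rewrite coset_cocycleE val1 mul1g mulg1 lmulc1.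
Qed.

End CosetCocycle.

Lemma ecast_const (I T : Type) (i j : I) (e : i = j) (x : T) :
  ecast k T e x = x.
Proof. by case: _ / e. Qed.

(** * Existence: the induced quasi-action *)

Section InducedMap.
Context {R : realType} {G : groupType} {H : groupClosed G}.
Context (finH : finite_index H) (X : metricType R).
Variable alpha : subgroup H -> X -> X.
Local Notation I := (lcosetF finH).
Local Notation Y := (fun _ : I => X).
Local Notation n := (#|{: I}|.+1%:R : R).

(** For an action [alpha] this is the action on sections of G x_H X over G/H, trivialised by the
    coset representatives. *)
Definition induced_map (g : G) : l2prod Y -> l2prod Y :=
  prod_map (X := Y) (s := lmul_perm finH g)
    (fun i => alpha (coset_cocycle g i)).

Lemma induced_mapE g x i :
  induced_map g x (lmulc g i) = alpha (coset_cocycle g i) (x i).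
Proof. by rewrite -lmul_permE; exact: (prod_mapE (X := Y)). Qed.

Lemma quasi_action_induced_map : quasi_action alpha -> quasi_action induced_map.
Proof.
move=> [L [A [alphaLA alphaM alpha1]]].
have alphaK h := quasi_isometry_with_const (alphaLA h).
have [L1 A0 _ _] := alphaLA 1%g.
set K := L * (A + 1) in alphaK; have AK : A <= K by rewrite /K; nra.
have K1 : 1 <= K by rewrite /K; nra.
exists (n * K), (n * K); split.
- move=> g; apply: const_quasi_isometry_with.
  apply: (quasi_isometry_const_coord (X := Y) (X' := Y) (s := lmulc g)
    (phi := fun i => alpha (coset_cocycle g i))) K1 _ (induced_mapE g) _ => //.
  exists (lmulc g^-1%g) => i; last exact: lmulcVK.
  by rewrite -lmulcM mulVg lmulc1.
- move=> g1 g2 z; apply: mdist_l2_le => [|j]; first by lra.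
  (* With [j] written as [g1 g2 i], the cocycle identity reduces the defect to that of [alpha] on
     one factor. *)
  rewrite -(lmulcVK (g1 * g2)%g j) induced_mapE {1}lmulcM !induced_mapE.
  by rewrite coset_cocycleM; apply: le_trans AK.
- move=> z; apply: mdist_l2_le => [|j]; first by lra.
  rewrite -[in leLHS](lmulc1 j) induced_mapE coset_cocycle1 lmulc1.
  exact: le_trans AK.
Qed.

Lemma splits_induced_map g D : quasi_action alpha -> 0 <= D ->
  splits_with (X := Y) D (induced_map g) (s := lmul_perm finH g)
    (fun i => alpha (coset_cocycle g i)).
Proof.
move=> [L [A [alphaLA _ _]]] D0; split=> [i|x]; first by exists L, A.
by rewrite mdistxx.
Qed.

Lemma induced_quasi_action_map :
  quasi_action alpha -> induced_quasi_action alpha induced_map.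
Proof.
move=> qa; have [L [A [alphaLA alphaM alpha1]]] := qa.
split.
- exact: quasi_action_induced_map.
- exists 0 => g; exists (lmul_perm finH g); eexists.
  exact: splits_induced_map.
- by move=> i; exists id; exact: quasi_isometry_id.
- by exists 0 => g; eexists; exact: splits_induced_map.
pose i0 := lcosetF_of finH 1%g.
have fixi0 (h : subgroup H) : lmul_perm finH (val h) i0 = i0.
  by apply/lmul_perm_stab; exact: valP.
exists (fun h => alpha (coset_cocycle (val h) i0)); split.
  exists 0 => h; exists (lmul_perm finH (val h)); eexists; exists (fixi0 h).
  split; first exact: splits_induced_map.
  by move=> x; rewrite ecast_const.
(* The representative [k] of the coset [H] lies in [H] but may differ from 1. The restriction is
   [alpha (k^-1 h k)]; [alpha k] conjugates it to [alpha h], as both composites are [A]-close to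
   [alpha (h * k)]. *)
have kH : coset_rep i0 \in H.
  have /(lcosets_eqP H) : lcosetF_of finH 1%g = lcosetF_of finH (coset_rep i0).
    by rewrite coset_repK.
  by rewrite invg1 mul1g.
pose k : subgroup H := exist (fun x : G => x \in H) _ kH.
exists (alpha k); split; first by exists L, A.
exists (A + A) => h z; apply: le_trans (metric_triangle _ _ _) _.
apply: lerD (alphaM _ _ _) _; rewrite metric_sym.
suff -> : (k * coset_cocycle (val h) i0 = h * k)%g by [].
apply: val_inj; rewrite !valM -coset_cocycleE.
by rewrite -[lmulc _ _]lmul_permE fixi0.
Qed.

Lemma isometric_action_induced_map :
  isometric_action alpha -> isometric_action induced_map.
Proof.
move=> [alpha_isom alphaM alpha1].
have mapM g1 g2 z :
    induced_map g1 (induced_map g2 z) = induced_map (g1 * g2)%g z.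
  apply: functional_extensionality_dep => j.
  rewrite -(lmulcVK (g1 * g2)%g j) induced_mapE {1}lmulcM !induced_mapE.
  by rewrite coset_cocycleM.
have map1 z : induced_map 1%g z = z.
  apply: functional_extensionality_dep => j.
  by rewrite -[in LHS](lmulc1 j) induced_mapE coset_cocycle1.
split=> // g; split.
  by exists (induced_map g^-1%g) => z; rewrite mapM ?mulVg ?mulgV map1.
move=> x y; rewrite !mdist_l2prodE; congr Num.sqrt.
rewrite (reindex_inj (@lmulc_inj _ _ finH g)).
apply: eq_bigr => i _; rewrite !induced_mapE.
by have [_ ->] := alpha_isom (coset_cocycle g i).
Qed.

End InducedMap.

Lemma splits_with_coord {R : realType} {I : finType} (Y : I -> metricType R) D
    (f : l2prod Y -> l2prod Y) (s : {perm I}) (phi : forall i, Y i -> Y (s i))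
    i j (e : s i = j) (x : l2prod Y) :
  splits_with D f phi ->
  mdist (f x j) (ecast k (Y k) e (phi i (x i))) <= D.
Proof.
move=> [_ fD]; apply: le_trans (fD x); case: _ / e.
by rewrite -(prod_mapE phi x i); exact: mdist_coord_le.
Qed.

(** * Factor maps with uniform constants *)

Section FactorMaps.
Context {R : realType} {G : groupType} {H : groupClosed G}.
Context (finH : finite_index H) (X : metricType R).
Local Notation I := (lcosetF finH).
Local Notation i0 := (lcosetF_of finH 1%g).

(* [F g i j] is phi_i^g when [j = g i], and junk otherwise; letting [j] be free
   avoids casts along equalities of cosets. *)
Record factor_maps (alpha : subgroup H -> X -> X) (Y : I -> metricType R)
    (beta : G -> l2prod Y -> l2prod Y) (F : G -> forall i j, Y i -> Y j)
    (psi : Y i0 -> X) (K : R) : Prop := FactorMaps {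
  fm_ge0 : 0 <= K;
  fm_coord : forall g i j x, lmulc g i = j ->
    mdist (beta g x j) (F g i j (x i)) <= K;
  fm_comp : forall g1 g2 i k j x, lmulc g2 i = k -> lmulc g1 k = j ->
    mdist (F g1 k j (F g2 i k x)) (F (g1 * g2)%g i j x) <= K;
  fm_lip : forall g i j x y,
    mdist (F g i j x) (F g i j y) <= K * mdist x y + K;
  fm_qi : forall g i j, lmulc g i = j -> quasi_isometry (F g i j);
  fm_psi : quasi_isometry psi;
  fm_conj : forall (h : subgroup H) x,
    mdist (psi (F (val h) i0 i0 x)) (alpha h (psi x)) <= K }.

(** The maps of a splitting are quasi-isometries with constants that may vary with [g]. Reading [F]
    off [beta] along the slice through [b] in direction [i] gives it the uniform constants of
    [beta]. *)
Lemma factor_maps_exist (alpha : subgroup H -> X -> X) (Y : I -> metricType R)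
    (beta : G -> l2prod Y -> l2prod Y) (b : l2prod Y) :
  induced_quasi_action alpha beta ->
  exists F psi K, factor_maps alpha beta F psi K.
Proof.
move=> [[L [A [betaLA betaM beta1]]] _ _ [D split_beta] [r [[E restr]]]].
move=> [psi [qpsi [C psiC]]].
pose F g i j (x : Y i) : Y j := beta g (dfwith b x) j.
have betaK g := quasi_isometry_with_const (betaLA g).
set M := L * (A + 1) in betaK.
have [P psiP] := (quasi_isometryP psi).1 qpsi.
have [P1 psi_up _ _] := psiP; have [M1 _ _ _] := betaK 1%g.
have A0 : 0 <= A by have [] := betaLA 1%g.
have D0 : 0 <= D.
  have [phi [_ /(_ b) bD]] := split_beta 1%g.
  exact: le_trans (mdist_ge0 _ _) bD.
have E0 : 0 <= E.
  have [s [phi [e [[_ /(_ b) bE] _]]]] := restr 1%g.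
  exact: le_trans (mdist_ge0 _ _) bE.
have C0 : 0 <= C by exact: le_trans (mdist_ge0 _ _) (psiC 1%g (b i0)).
have n1 : 1 <= #|{: I}|.+1%:R :> R by rewrite ler1n.
set n := #|{: I}|.+1%:R in n1.
(* Both points are within [D] of the cast of [phi i (x i)]. *)
have Fcoord g i j x : lmulc g i = j ->
    mdist (beta g x j) (F g i j (x i)) <= D + D.
  move=> gij; have [phi sp] := split_beta g.
  have e : lmul_perm finH g i = j by rewrite lmul_permE.
  apply: le_trans (metric_triangle _ (ecast k (Y k) e (phi i (x i))) _) _.
  apply: lerD; first exact: splits_with_coord.
  rewrite metric_sym /F -[in X in ecast _ _ _ X](dfwith_in b (x i)).
  exact: splits_with_coord.
(* The summands serve [fm_coord] ([D + D]), [fm_comp] (with [A]), [fm_lip] ([n * M]) and [fm_conj]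
   (the rest). *)
pose K := D + D + A + n * M + (P * E + P) + C.
have nM : M <= n * M by nra.
have PE : 0 <= P * E by nra.
exists F, psi, K; split=> //.
- by rewrite /K; lra.
- move=> g i j x gij; apply: le_trans (Fcoord _ _ _ _ gij) _; rewrite /K; lra.
(* Coordinate [k] of [beta g2 (dfwith b x)] is [F g2 i k x] by definition, so [Fcoord] applies at
   that point. *)
- move=> g1 g2 i k j x _ kj.
  have := Fcoord g1 k j (beta g2 (dfwith b x)) kj; rewrite metric_sym => h1.
  have := metric_triangle (F g1 k j (F g2 i k x))
            (beta g1 (beta g2 (dfwith b x)) j) (F (g1 * g2)%g i j x).
  have := le_trans (mdist_coord_le _ _ j) (betaM g1 g2 (dfwith b x)).
  by move: h1; rewrite /F /K; lra.
- move=> g i j x y; have [_ up _ _] := betaK g.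
  apply: le_trans (mdist_coord_le _ _ j) _; apply: le_trans (up _ _) _.
  have : mdist (dfwith b x : l2prod Y) (dfwith b y) <= n * mdist x y.
    apply: mdist_l2_le => [|k]; first exact: mdist_ge0.
    case: dfwithP => [|{}k ki]; first by rewrite dfwith_in.
    by rewrite dfwith_out// mdistxx mdist_ge0.
  move=> dn; apply: lerD; last by rewrite /K; lra.
  apply: (@le_trans _ _ (M * (n * mdist x y))).
    by rewrite ler_wpM2l//; lra.
  by rewrite mulrA [M * n]mulrC ler_wpM2r ?mdist_ge0// /K; lra.
- move=> g i j gij; have [phi sp] := split_beta g.
  have e : lmul_perm finH g i = j by rewrite lmul_permE.
  have : quasi_isometry (fun x => ecast k (Y k) e (phi i x)).
    by have [qphi _] := sp; case: _ / e; exact: qphi.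
  apply: quasi_isometry_close; exists D => x; rewrite metric_sym.
  rewrite /F -[in X in ecast _ _ _ X](dfwith_in b x).
  exact: splits_with_coord.
(* The splitting behind [r] may differ from that of [split_beta], but it too approximates [beta],
   from which [F] is read off. *)
- move=> h x; have [s [phi [e [sp rE]]]] := restr h.
  have Fr : mdist (F (val h) i0 i0 x) (r h x) <= E.
    rewrite rE -[in X in ecast _ _ _ X](dfwith_in b x).
    exact: splits_with_coord.
  have := psi_up (F (val h) i0 i0 x) (r h x); have := psiC h x.
  have := metric_triangle (psi (F (val h) i0 i0 x)) (psi (r h x))
            (alpha h (psi x)).
  rewrite /K; nra.
Qed.

(** * Uniqueness up to product quasi-isometry *)

Section Uniqueness.
Variables (alpha : subgroup H -> X -> X) (Y Y' : I -> metricType R).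
Variables (beta : G -> l2prod Y -> l2prod Y).
Variables (beta' : G -> l2prod Y' -> l2prod Y').
Variables (F : G -> forall i j, Y i -> Y j) (psi : Y i0 -> X) (K : R).
Variables (F' : G -> forall i j, Y' i -> Y' j) (psi' : Y' i0 -> X) (K' : R).
Arguments F : clear implicits.
Arguments F' : clear implicits.
Hypothesis FM : factor_maps alpha beta F psi K.
Hypothesis FM' : factor_maps alpha beta' F' psi' K'.

(** Both restrictions are compared with [alpha], by [psi] and then by a quasi-inverse [chi] of
    [psi']. *)
Lemma base_conjugacy : quasi_action alpha ->
  exists (phi : Y i0 -> Y' i0) (C : R), quasi_isometry phi /\
    forall (h : subgroup H) y,
      mdist (phi (F (val h) i0 i0 y)) (F' (val h) i0 i0 (phi y)) <= C.
Proof.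
move=> [L [A [alphaLA _ _]]].
have [chi [qchi [C1 psichi] [C2 chipsi]]] :=
  quasi_isometry_inverse (fm_psi FM').
have [P [P1 chi_up _ _]] := (quasi_isometryP chi).1 qchi.
(* [K] and [K'] come from the two conjugacies, [L * C1 + A] from [alpha h] applied to [psi y] and
   [psi' (chi (psi y))]; [chi] distorts the sum, and [C2] undoes [chi \o psi']. *)
exists (chi \o psi), (P * (K + (L * C1 + A) + K') + P + C2).
split=> [|h y /=]; first exact: quasi_isometry_comp (fm_psi FM) qchi.
have [L1 A0 alpha_lip _] := alphaLA h.
set y' := chi (psi y).
apply: le_trans (metric_triangle _ (chi (psi' (F' (val h) i0 i0 y'))) _) _.
apply: lerD; last exact: chipsi.
apply: le_trans (chi_up _ _) _; rewrite lerD2r ler_pM2l; last lra.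
apply: le_trans (mdist_path3 _ (alpha h (psi y)) (alpha h (psi' y')) _) _.
apply: lerD; last by rewrite metric_sym; exact: (fm_conj FM' _ _).
apply: lerD; first exact: (fm_conj FM _ _).
have [_ up] := alpha_lip (psi y) (psi' y'); apply: le_trans up _.
rewrite lerD2r ler_pM2l; last lra.
by rewrite metric_sym; exact: psichi.
Qed.

(* phi_i := (beta' g_i) o phi_{i0} o (beta g_i^-1), with [g_i] the chosen
   representative of the coset [i]. *)
Lemma factor_maps_conjugate : quasi_action alpha ->
  exists phi : l2prod Y -> l2prod Y',
    product_quasi_isometry phi /\ quasi_conjugate_via beta beta' phi.
Proof.
move=> /base_conjugacy[phi0 [C [qphi0 phi0C]]].
have [P [P1 phi0_up _ _]] := (quasi_isometryP phi0).1 qphi0.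
have repV i : lmulc (coset_rep i)^-1%g i = i0.
  by rewrite -[in X in lmulc _ X](lmulc_rep i) -lmulcM mulVg lmulc1.
pose phi i (x : Y i) : Y' i :=
  F' (coset_rep i) i0 i (phi0 (F (coset_rep i)^-1%g i i0 x)).
have qphi i : quasi_isometry (phi i).
  exact: (quasi_isometry_comp (fm_qi FM (repV i))
            (quasi_isometry_comp qphi0 (fm_qi FM' (lmulc_rep i)))).
pose Phi (x : l2prod Y) : l2prod Y' := fun i => phi i (x i).
have qPhi : quasi_isometry Phi by exact: quasi_isometry_pointwise.
exists Phi; split.
  by split=> //; exists phi; split=> //; exists 0 => x; rewrite mdistxx.
split=> //.
(* Errors accumulated after [F gj^-1], after [phi0], and at the end. *)
pose c1 := K * K + K + K + K.
pose c2 := P * c1 + P + C.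
pose c3 := K' * c2 + K' + K' + (K' + K').
exists (#|{: I}|.+1%:R * `|c3|) => g x; apply: mdist_l2_le => [//|j].
apply: le_trans (ler_norm _).
pose i := lmulc g^-1%g j; have gij : lmulc g i = j by exact: lmulcVK.
pose gi := coset_rep i; pose gj := coset_rep j; pose h := coset_cocycle g i.
have gjh : (gj * val h = g * gi)%g by rewrite -coset_cocycleE gij.
have gjg : (gj^-1 * g = val h * gi^-1)%g.
  by apply: (mulgI gj); rewrite mulVKg mulgA gjh mulgK.
have hi0 : lmulc (val h) i0 = i0.
  by rewrite -lmul_permE; apply/lmul_perm_stab; exact: valP.
have K0 := fm_ge0 FM; have K'0 := fm_ge0 FM'.
set y := F gi^-1%g i i0 (x i).
have d1 : mdist (F gj^-1%g j i0 (beta g x j)) (F (val h) i0 i0 y) <= c1.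
  apply: le_trans (mdist_path3 _ (F gj^-1%g j i0 (F g i j (x i)))
    (F (gj^-1 * g)%g i i0 (x i)) _) _.
  apply: lerD; first apply: lerD.
  - apply: le_trans (fm_lip FM _ _ _ _) _; rewrite lerD2r ler_wpM2l//.
    exact: (fm_coord FM _ gij).
  - exact: (fm_comp FM _ gij (repV j)).
  - by rewrite gjg metric_sym; exact: (fm_comp FM _ (repV i) hi0).
have d2 : mdist (phi0 (F gj^-1%g j i0 (beta g x j)))
    (F' (val h) i0 i0 (phi0 y)) <= c2.
  apply: le_trans (metric_triangle _ (phi0 (F (val h) i0 i0 y)) _) _.
  apply: lerD; last exact: phi0C.
  by apply: le_trans (phi0_up _ _) _; rewrite lerD2r ler_pM2l//; lra.
(* As [gj * val h = g * gi], this midpoint is near both [F' gj] after [F' h] and [F' g] after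
   [F' gi], each applied to [phi0 y]. *)
apply: le_trans (metric_triangle _ (F' (gj * val h)%g i0 j (phi0 y)) _) _.
apply: lerD.
  apply: le_trans (metric_triangle _
    (F' gj i0 j (F' (val h) i0 i0 (phi0 y))) _) _.
  apply: lerD; last exact: (fm_comp FM' _ hi0 (lmulc_rep j)).
  by apply: le_trans (fm_lip FM' _ _ _ _) _; rewrite lerD2r ler_wpM2l.
rewrite gjh metric_sym.
apply: le_trans (metric_triangle _ (F' g i j (Phi x i)) _) _.
apply: lerD; first exact: (fm_coord FM' _ gij).
exact: (fm_comp FM' _ (lmulc_rep i) gij).
Qed.

End Uniqueness.
End FactorMaps.

Theorem theorem1p2 (R : realType) (G : groupType) (H : groupClosed G)
    (finH : finite_index H) (X : metricType R)
    (alpha : subgroup H -> X -> X) :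
  unbounded X -> quasi_action alpha ->
  [/\ exists (Y : lcosetF finH -> metricType R) (beta : G -> l2prod Y -> l2prod Y),
        induced_quasi_action alpha beta,
      forall (Y Y' : lcosetF finH -> metricType R)
          (beta : G -> l2prod Y -> l2prod Y) (beta' : G -> l2prod Y' -> l2prod Y'),
        induced_quasi_action alpha beta -> induced_quasi_action alpha beta' ->
        exists phi : l2prod Y -> l2prod Y',
          product_quasi_isometry phi /\ quasi_conjugate_via beta beta' phi
    & isometric_action alpha ->
      exists (Y : lcosetF finH -> metricType R) (beta : G -> l2prod Y -> l2prod Y),
        [/\ induced_quasi_action alpha beta,
            forall i, isometric (Y i) X
          & isometric_action beta]].
Proof.
move=> unboundedX qa; have [x0 _] := unboundedX 0; split.
- by exists (fun=> X), (induced_map alpha); exact: induced_quasi_action_map.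
- move=> Y Y' beta beta' ind ind'.
  (* Unboundedness gave the point [x0] of [X]; coarse surjectivity then yields a base point in every
     factor. *)
  have base (Z : lcosetF finH -> metricType R)
      (gamma : G -> l2prod Z -> l2prod Z) :
      induced_quasi_action alpha gamma -> forall i, {z : Z i | True}.
    move=> [_ _ qi _ _] i; apply: cid.
    have [f [L [A [_ _ _ /(_ x0)[z _]]]]] := qi i; by exists z.
  have [F [psi [K FM]]] :=
    factor_maps_exist (fun i => sval (base _ _ ind i)) ind.
  have [F' [psi' [K' FM']]] :=
    factor_maps_exist (fun i => sval (base _ _ ind' i)) ind'.
  exact: factor_maps_conjugate FM FM' qa.
- move=> isom; exists (fun=> X), (induced_map alpha); split.
  + exact: induced_quasi_action_map.
  + by move=> i; exists id; split=> //; exists id.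
  + exact: isometric_action_induced_map.
Qed.
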